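(* For any $D > 0$, there exists a finite solvable group whose $3$-local commensurability graph has connected diameter greater than $D$.
   Context: For a group $G$ and a prime $p$, the $p$-local commensurability graph $\Gamma_p(G)$ has as vertices all finite-index subgroups of $G$, and an edge is drawn between (distinct) $A$ and $B$ if $[A: A\cap B][B: A\cap B]$ is a power of $p$ (where $1=p^0$ counts as a power of $p$). The connected diameter of a graph is the supremum, over all connected components of the graph, of the graph diameter of the component. *)

(* Defs.v *)
From mathcomp Require Import all_boot all_fingroup all_solvable.

Set Implicit Arguments.
Unset Strict Implicit.
Unset Printing Implicit Defensive.

Section GraphDiameter.

Variables (T : finType) (e : rel T).

Definition walk (n : nat) (x y : T) : bool :=
  [exists t : n.-tuple T, path e x t && (last x t == y)].

(* The length of a shortest walk from x to y. The range n < #|T| suffices,   *)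
(* since a shortest walk is duplicate-free; the value #|T| is returned iff x *)
(* and y are not connected. See gdist_walk, gdist_min and gdist_lt below.    *)
Definition gdist (x y : T) : nat :=
  find (fun n => walk n x y) (iota 0 #|T|).

Definition components : {set {set T}} :=
  equivalence_partition (connect e) [set: T].

Definition diameter (C : {set T}) : nat :=
  \max_(x in C) \max_(y in C) gdist x y.

Definition connected_diameter : nat := \max_(C in components) diameter C.

Lemma walkP n x y :
  reflect (exists p, [/\ path e x p, last x p = y & size p = n]) (walk n x y).
Proof.
apply: (iffP existsP) => [[t /andP[pt /eqP lt]] | [p [pp lp sp]]].
  by exists t; rewrite size_tuple.
by exists (tcast sp (in_tuple p)); rewrite val_tcast pp lp /=.
Qed.

Lemma gdist_lt x y : (gdist x y < #|T|) = connect e x y.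
Proof.
rewrite /gdist -[X in _ < X](size_iota 0) -has_find.
apply/hasP/connectP => [[n _ /walkP[p [pp lp _]]] | [p pp ->]]; first by exists p.
have [p' pp' up' _] := shortenP pp.
exists (size p'); last by apply/walkP; exists p'.
by rewrite mem_iota /= add0n; have := max_card (mem (x :: p')); rewrite (card_uniqP up').
Qed.

Lemma gdist_walk x y : connect e x y -> walk (gdist x y) x y.
Proof.
rewrite -gdist_lt => lt_d; have := lt_d.
rewrite /gdist -[X in _ < X](size_iota 0) -has_find => /(nth_find 0).
by rewrite nth_iota.
Qed.

Lemma gdist_min n x y : walk n x y -> gdist x y <= n.
Proof.
move=> wn; rewrite leqNgt; apply/negP => lt_n.
have n_lt : n < #|T|.
  by apply: leq_trans lt_n _; rewrite -[X in _ <= X](size_iota 0) find_size.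
by have := before_find 0 lt_n; rewrite nth_iota // wn.
Qed.

Lemma componentsP C :
  reflect (exists x, C = [set y | connect e x y]) (C \in components).
Proof.
have cE x : [set y in [set: T] | connect e x y] = [set y | connect e x y].
  by apply/setP=> y; rewrite !inE.
apply: (iffP imsetP) => [[x _ ->] | [x ->]]; exists x; rewrite ?cE //.
Qed.

End GraphDiameter.

Section LocalCommensurability.

Local Open Scope group_scope.

Variables (gT : finGroupType) (G : {group gT}) (p : nat).

(* The vertices are all subgroups of G: each has finite index since G is     *)
(* finite. For p prime, p.-nat n holds iff n is a power of p (1 included);   *)
(* see local_commensurabilityP.                                              *)
Definition local_commensurability : rel {H : {group gT} | H \subset G} :=
  fun A B => (A != B) &&
    p.-nat (#|val A : val A :&: val B| * #|val B : val A :&: val B|)%N.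

Lemma local_commensurabilityP (A B : {H : {group gT} | H \subset G}) :
  prime p ->
  reflect (A <> B /\ exists k,
             (#|val A : val A :&: val B| * #|val B : val A :&: val B| = p ^ k)%N)
          (local_commensurability A B).
Proof.
move=> p_pr; apply: (iffP andP) => [[/eqP neqAB /p_natP[k ->]] | [neqAB [k def_k]]].
  by split=> //; exists k.
by split; [apply/eqP | rewrite def_k pnatX pnat_id].
Qed.

Lemma local_commensurability_sym : symmetric local_commensurability.
Proof. by move=> A B; rewrite /local_commensurability eq_sym mulnC setIC. Qed.

Lemma local_commensurability_irr : irreflexive local_commensurability.
Proof. by move=> A; rewrite /local_commensurability eqxx. Qed.

End LocalCommensurability.

Arguments local_commensurability {gT} G p A B.

(* Main.v *)
(* In a group of order 2 3^k, any two involutions differ by a 3-element. So if a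
   walk of length m in the graph joins <r> to <r'>, with r and r' involutions,
   then r' r^-1 is a product of m + 1 elements of 3-power order. Let E = F_3^n,
   with dual space E^*. The group G acts on triples (c, x, b) in
   E^* * F_3 * F_2 by
     (c, x, b) |-> (c, +-x + c(a), b + f(c, x)),   a in E, f arbitrary,
   the sign being independent of c. A 3-element of G has sign +, and is trivial
   over c as soon as c(a) = 0. Fewer than n of them have a common c != 0 with
   this property, so that their product is trivial over that c. Now let r be
   (c, x, b) |-> (c, -x, b) and let r' be the conjugate of r by the map that
   flips b over all (c, 1) with c != 0: r' r^-1 is nontrivial over every c != 0,
   hence <r> and <r'> are at distance at least n - 1. They are connected, for
   <r> is connected to its conjugates by the translations, which r inverts, and
   by the flips over (c, 0), which commute with r; conjugating the latter by
   the former gives the flips over (c, 1). *)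

Require Import Defs.
From mathcomp Require Import all_boot all_fingroup all_solvable all_algebra.

Set Implicit Arguments.
Unset Strict Implicit.
Unset Printing Implicit Defensive.

(** * Walks starting at a subgroup with an involution *)

Section InvolutionPaths.

Local Open Scope group_scope.

Variables (gT : finGroupType) (G : {group gT}) (p : nat).
Hypothesis p_odd : odd p.

Local Notation vertex := {H : {group gT} | H \subset G}.
Local Notation e := (local_commensurability G p).

(** Since [p] is odd, so is the order of [q]; hence [q] is a power of [q ^+ 2]. *)
Lemma p_elt_sq_mem (H : {group gT}) q : p.-elt q -> q ^+ 2 \in H -> q \in H.
Proof.
move=> pq q2H.
have co : coprime #[q] 2.
  rewrite /p_elt in pq; apply: pnat_coprime pq _.
  by rewrite pnatE // !inE eq_sym; apply: contraTneq p_odd => ->.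
have /eqP defq : generator <[q]> (q ^+ 2) by rewrite generator_coprime.
by apply: (subsetP (_ : <[q]> \subset H)); rewrite ?cycle_id // defq cycle_subG.
Qed.

(** A Sylow [p]-subgroup of [A] has index 2, and both involutions lie in its nontrivial coset. *)
Lemma order2_mulV_p_elt (A : {group gT}) u v :
  (#|A|`_p^' = 2)%N -> u \in A -> #[u] = 2 -> v \in A -> #[v] = 2 ->
  p.-elt (v * u^-1).
Proof.
move=> cA uA ou vA ov.
have [P sylP] := Sylow_exists p A.
have [sPA pP _] := and3P sylP.
have iP : #|A : P| = 2.
  apply/eqP; rewrite -(eqn_pmul2l (cardG_gt0 P)) Lagrange // (card_Hall sylP).
  by rewrite -cA partnC.
have notP w : w \in A -> #[w] = 2 -> w \in A :\: P.
  move=> wA ow; rewrite inE wA andbT; apply/negP => /(mem_p_elt pP).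
  by rewrite /p_elt ow pnatE // inE => /eqP p2; move: p_odd; rewrite -p2.
apply: (mem_p_elt pP).
by rewrite -mem_rcoset (rcoset_index2 sPA iP) notP.
Qed.

(** Both indices are powers of [p], so Lagrange leaves the [p^']-parts unchanged. *)
Lemma local_commensurability_part (A B : vertex) : e A B ->
  (#|val A :&: val B|`_p^' = #|val A|`_p^')%N
  /\ (#|val A :&: val B|`_p^' = #|val B|`_p^')%N.
Proof.
case/andP=> _; rewrite pnatM => /andP[iA iB].
split.
  rewrite -(Lagrange (subsetIl (val A) (val B))) partnM ?cardG_gt0 //.
  by rewrite [(#|_ : _|`__)%N]part_p'nat ?muln1 // pnatNK.
rewrite -(Lagrange (subsetIr (val A) (val B))) partnM ?cardG_gt0 //.
by rewrite [(#|_ : _|`__)%N]part_p'nat ?muln1 // pnatNK.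
Qed.

(* Consecutive vertices of the walk share an involution, and two involutions of
   one vertex differ by an element of its normal Sylow p-subgroup. *)
Lemma path_prod_p_elt (A : vertex) (s : seq vertex) u v :
  path e A s -> (#|val A|`_p^' = 2)%N -> u \in val A -> #[u] = 2 ->
  v \in val (last A s) -> #[v] = 2 ->
  exists2 qs : seq gT, size qs = (size s).+1 &
    all (fun q => (q \in G) && p.-elt q) qs /\ v = (\prod_(q <- qs) q) * u.
Proof.
move=> + + uA ou + ov.
elim: s A u uA ou => [|B s IHs] A u uA ou /=.
  move=> _ cA vA; exists [:: v * u^-1] => //=.
  rewrite (order2_mulV_p_elt cA) // big_seq1 mulgKV.
  by rewrite groupM ?groupV ?(subsetP (valP A)).
case/andP=> AB pBs cA vl.
have [cIA cIB] := local_commensurability_part AB.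
have /(Cauchy (isT : prime 2))[w] : 2 %| #|(val A :&: val B)%G|.
  by rewrite -cA -cIA dvdn_part.
rewrite inE => /andP[wA wB] ow.
have [|qs sqs [qsP ->]] := IHs B w wB ow pBs _ vl; first by rewrite -cIB cIA.
exists (rcons qs (w * u^-1)); first by rewrite size_rcons sqs.
rewrite all_rcons qsP (order2_mulV_p_elt cA) // big_rcons /=.
by rewrite mulgA mulgKV groupM ?groupV ?(subsetP (valP A)).
Qed.

(* Total in A, with junk value G when A is not a subgroup of G. *)
Definition subgroup_vertex (A : {group gT}) : vertex :=
  insubd (exist _ G (subxx G)) A.

(** * Connecting cyclic subgroups to their conjugates *)

Local Notation vtx := subgroup_vertex.

Lemma val_subgroup_vertex (A : {group gT}) : A \subset G -> val (vtx A) = A.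
Proof. by move=> sAG; rewrite insubdK. Qed.

Lemma connect_subgroup_vertex (A B : {group gT}) :
  A \subset B -> B \subset G -> p.-nat #|B : A| -> connect e (vtx A) (vtx B).
Proof.
move=> sAB sBG pBA; have sAG := subset_trans sAB sBG.
have [<-|nAB] := eqVneq (vtx A) (vtx B); first exact: connect0.
apply: connect1; rewrite /local_commensurability nAB !val_subgroup_vertex //=.
by rewrite (setIidPl sAB) indexgg mul1n.
Qed.

(** Conjugation by [g] preserves indices, so it maps walks to walks. *)
Lemma connect_conj g (A B : {group gT}) :
  g \in G -> A \subset G -> B \subset G ->
  connect e (vtx A) (vtx B) -> connect e (vtx (A :^ g)%G) (vtx (B :^ g)%G).
Proof.
move=> gG sAG sBG /connectP[s es ls].
pose f (C : vertex) := vtx (val C :^ g)%G.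
have sC (C : vertex) : val C :^ g \subset G.
  by case: C => C /= sCG; rewrite -(conjGid gG) conjSg.
have f_homo : {homo f : C C' / e C C' >-> e C C'}.
  move=> C C' /andP[nC eC]; rewrite /local_commensurability.
  rewrite -val_eqE !val_subgroup_vertex /=; [|exact: sC..].
  rewrite -conjIg !indexJg eC andbT.
  apply: contra nC => /eqP/(congr1 val)/= /conjsg_inj eqC.
  by apply/eqP/val_inj/val_inj.
have fE (C : {group gT}) : C \subset G -> f (vtx C) = vtx (C :^ g)%G.
  by move=> sCG; rewrite /f val_subgroup_vertex.
rewrite -!fE // ls -last_map; apply/connectP; exists (map f s) => //.
exact: homo_path f_homo es.
Qed.

Lemma local_commensurability_connect_sym : connect_sym e.
Proof. exact/sym_connect_sym/local_commensurability_sym. Qed.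

Section Linked.

Variable t : gT.
Hypothesis tG : t \in G.

(* A subgroup of G, since conjugation by G preserves adjacency. *)
Definition linked : {set gT} :=
  [set g in G | connect e (vtx <[t]>%G) (vtx <[t ^ g]>%G)].

Lemma group_set_linked : group_set linked.
Proof.
apply/group_setP; split=> [|g h]; first by rewrite inE group1 conjg1 connect0.
rewrite !inE => /andP[gG cg] /andP[hG ch]; rewrite groupM //=.
(* It remains to join [<[t ^ h]>] to [<[t ^ (g * h)]>]: conjugate by [h] the walk given by [cg]. *)
apply: connect_trans ch _.
have cyJ (x y : gT) : <[x ^ y]>%G = (<[x]> :^ y)%G.
  by apply: val_inj; rewrite /= cycleJ.
by rewrite conjgM (cyJ t h) (cyJ _ h) connect_conj // cycle_subG ?groupJ.
Qed.

Canonical linked_group := Group group_set_linked.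

Lemma mem_linked_commute g : g \in G -> commute t g -> g \in linked.
Proof. by move=> gG ctg; rewrite inE gG conjgE ctg mulKg connect0. Qed.

(** As [t] normalizes [<[q]>], the join [A] has order [#[q] * 2]. Both [<[t]>] and [<[t ^ q]>] have
    index [#[q]] in [A], a power of [p], so both are connected to [A]. *)
Lemma mem_linked_invert q : #[t] = 2 -> q \in G -> p.-elt q -> q ^ t = q^-1 ->
  q \in linked.
Proof.
move=> ot qG pq qt; rewrite inE qG /=.
pose A := (<[q]> <*> <[t]>)%G.
have nqt : <[t]> \subset 'N(<[q]>).
  by rewrite cycle_subG inE -cycleJ qt cycleV.
have oA : #|A| = (#[q] * 2)%N.
  rewrite /= norm_joinEr // coprime_cardMg -?[#|<[t]>|]/#[t] ?ot //.
  apply: pnat_coprime pq _.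
  by rewrite pnatE // !inE eq_sym; apply: contraTneq p_odd => ->.
have tA : t \in A by rewrite mem_gen // inE cycle_id orbT.
have qA : q \in A by rewrite mem_gen // inE cycle_id.
have sAG : A \subset G by rewrite join_subG !cycle_subG qG tG.
have cA u : u \in A -> #[u] = 2 -> connect e (vtx <[u]>%G) (vtx A).
  move=> uA ou; apply: connect_subgroup_vertex; rewrite ?cycle_subG //.
  suff /eqP -> : #|A : <[u]>| == #[q] by [].
  rewrite -(eqn_pmul2l (cardG_gt0 <[u]>)) Lagrange ?cycle_subG // oA.
  by rewrite -[#|<[u]>|]/#[u] ou mulnC.
apply: (connect_trans (cA t tA ot)); rewrite local_commensurability_connect_sym.
by apply: cA; rewrite ?groupJ ?orderJ.
Qed.

End Linked.

End InvolutionPaths.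

(** * The affine permutation group and its solvability *)

Section AffineGroup.

Import GRing.Theory.
Local Open Scope ring_scope.

Variable n : nat.

Definition point : finType := ('rV['F_3]_n * 'F_3 * bool)%type.

(** The last coordinate of [g w] is left free; this freedom is the arbitrary f of the overview. *)
Definition affine (s : bool) (a : 'cV['F_3]_n) : {set {perm point}} :=
  [set g : {perm point} | [forall w : point,
     (g w).1 == (w.1.1, (-1) ^+ s * w.1.2 + (w.1.1 *m a) 0 0)]].

Lemma affineP (s : bool) (a : 'cV_n) (g : {perm point}) :
  reflect (forall c x b, (g (c, x, b)).1 = (c, (-1) ^+ s * x + (c *m a) 0 0))
          (g \in affine s a).
Proof.
rewrite inE; apply: (iffP forallP) => [gP c x b|gP [[c x] b]].
  exact/eqP/(gP (c, x, b)).
exact/eqP/gP.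
Qed.

Lemma affineM (s t : bool) (a b : 'cV_n) (g h : {perm point}) :
  g \in affine s a -> h \in affine t b ->
  (g * h)%g \in affine (s (+) t) ((-1) ^+ t *: a + b).
Proof.
move=> /affineP gP /affineP hP; apply/affineP => c x d.
rewrite permM; move: (gP c x d); case: (g _) => y d' /= ->.
rewrite hP mulmxDr -scalemxAr !mxE signr_addb mulrDr mulrA addrA.
by rewrite [_ ^+ s * _]mulrC.
Qed.

(** Serves for commutators, written as [(h * g)^-1 * (g * h)]: the two products have the same
    sign. *)
Lemma affineVM (s : bool) (a b : 'cV_n) (g h : {perm point}) :
  g \in affine s a -> h \in affine s b ->
  (g^-1 * h)%g \in affine false (b - a).
Proof.
move=> /affineP gP /affineP hP; apply/affineP => c x d.
rewrite permM; case E: (g^-1%g _) => [[c' x'] d'].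
have : (g (c', x', d')).1 = (c, x) by rewrite -E permKV.
rewrite gP => -[<- <-]; rewrite hP expr0 mul1r.
have -> : (c' *m (b - a)) 0 0 = (c' *m b) 0 0 - (c' *m a) 0 0.
  by rewrite mulmxBr !mxE.
by rewrite -addrA (addrC _ (_ - _)) subrK.
Qed.

Definition affine_perms : {set {perm point}} :=
  [set g | [exists s, exists a, g \in affine s a]].

Lemma affine_permsP g :
  reflect (exists s a, g \in affine s a) (g \in affine_perms).
Proof.
rewrite inE; apply: (iffP existsP) => -[s].
  by move/existsP=> [a ga]; exists s, a.
by move=> [a ga]; exists s; apply/existsP; exists a.
Qed.

Definition translation_perms : {set {perm point}} :=
  [set g | [exists a, g \in affine false a]].

Lemma translation_permsP g :
  reflect (exists a, g \in affine false a) (g \in translation_perms).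
Proof. by rewrite inE; apply: existsP. Qed.

Lemma affine1 : (1%g : {perm point}) \in affine false 0.
Proof. by apply/affineP=> c x b; rewrite perm1 mulmx0 mxE mul1r addr0. Qed.

Lemma group_set_affine_perms : group_set affine_perms.
Proof.
apply/group_setP; split.
  by apply/affine_permsP; exists false, 0; apply: affine1.
move=> g h /affine_permsP[s [a ga]] /affine_permsP[t [b hb]].
by apply/affine_permsP; do 2!eexists; apply: affineM ga hb.
Qed.
Canonical affine_group := Group group_set_affine_perms.

Lemma group_set_translation_perms : group_set translation_perms.
Proof.
apply/group_setP; split.
  by apply/translation_permsP; exists 0; apply: affine1.
move=> g h /translation_permsP[a ga] /translation_permsP[b hb].
by apply/translation_permsP; eexists; apply: affineM ga hb.
Qed.
Canonical translation_group := Group group_set_translation_perms.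

Lemma group_set_fiberwise : group_set (affine false 0).
Proof.
apply/group_setP; split=> [|g h ga hb]; first exact: affine1.
by have := affineM ga hb; rewrite scaler0 addr0.
Qed.
Canonical fiberwise_group := Group group_set_fiberwise.

(** Over [y], [g] permutes two points, and a permutation of [bool] adds the image of [false]. *)
Lemma fiberwiseE (g : {perm point}) y b : g \in affine false 0 ->
  g (y, b) = (y, b (+) (g (y, false)).2).
Proof.
move=> /affineP gP; case: y => c x.
have gE b' : g (c, x, b') = (c, x, (g (c, x, b')).2).
  by rewrite [LHS]surjective_pairing gP mulmx0 mxE mul1r addr0.
case: b; last by rewrite gE.
rewrite gE; congr (_, _).
have : (g (c, x, true)).2 != (g (c, x, false)).2.
  apply: contra_notN (_ : g (c, x, true) <> g (c, x, false)).
    by move=> /eqP eq2; rewrite gE eq2 -gE.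
  by move/perm_inj.
by case: (g (c, x, true)).2; case: (g (c, x, false)).2.
Qed.

Lemma affine_group_solvable : solvable affine_group.
Proof.
(* Signs commute, so commutators have sign +; for sign + the vectors [a] add, so commutators have
   [a = 0]; for [a = 0] the action on each fibre is by addition in F_2, which is abelian. *)
apply/derivedP; exists 3%N.
have comm_le (A B : {group {perm point}}) :
    {in A &, forall g h, ((h * g)^-1 * (g * h))%g \in B} ->
    [~: A, A]%g \subset B.
  move=> AB; rewrite gen_subG; apply/subsetP=> _ /imset2P[g h gA hA ->].
  by have := AB g h gA hA; rewrite commgEl conjgE invMg !mulgA.
have d1 : (affine_group^`(1))%g \subset translation_group.
  apply: comm_le => g h /affine_permsP[s [a ga]] /affine_permsP[t [b hb]].
  have := affineM ga hb; rewrite addbC => /(affineVM (affineM hb ga)) comm_gh.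
  by apply/translation_permsP; eexists; apply: comm_gh.
have d2 : (translation_group^`(1))%g \subset fiberwise_group.
  apply: comm_le => g h /translation_permsP[a ga] /translation_permsP[b hb].
  have := affineVM (affineM hb ga) (affineM ga hb).
  by rewrite !scale1r [b + a]addrC subrr.
have d3 : (fiberwise_group^`(1))%g = 1%g.
  apply/derG1P/centsP=> g gF h hF; apply/permP=> -[y b].
  rewrite !permM (fiberwiseE y b gF) (fiberwiseE y b hF).
  by rewrite (fiberwiseE y (b (+) _) gF) (fiberwiseE y (b (+) _) hF) addbAC.
apply/trivgP; rewrite -d3.
have d2' : (affine_group^`(2))%g \subset fiberwise_group.
  by apply: subset_trans d2; apply: commgSS.
by apply: commgSS.
Qed.

(** * Reflection, translations and flips *)

Definition reflection_fun (w : point) : point := (w.1.1, - w.1.2, w.2).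

Lemma reflection_funK : involutive reflection_fun.
Proof. by case=> -[c x] b; rewrite /reflection_fun /= opprK. Qed.

Definition reflection : {perm point} := perm (inv_inj reflection_funK).

Definition translation_fun (a : 'cV['F_3]_n) (w : point) : point :=
  (w.1.1, w.1.2 + (w.1.1 *m a) 0 0, w.2).

Lemma translation_fun_inj a : injective (translation_fun a).
Proof. move=> [[c x] b] [[c' x'] b'] /eqP; rewrite !xpair_eqE /=.
by case/andP=> /andP[/eqP-> /eqP/addIr->] /eqP->. Qed.

Definition translation a : {perm point} := perm (@translation_fun_inj a).

Definition flip_fun (Z : {set 'rV['F_3]_n * 'F_3}) (w : point) : point :=
  (w.1, w.2 (+) (w.1 \in Z)).

Lemma flip_funK Z : involutive (flip_fun Z).
Proof. by case=> y b; rewrite /flip_fun /= addbK. Qed.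

Definition flip Z : {perm point} := perm (inv_inj (flip_funK Z)).

Lemma reflectionE c x b : reflection (c, x, b) = (c, - x, b).
Proof. by rewrite permE. Qed.

Lemma translationE a c x b :
  translation a (c, x, b) = (c, x + (c *m a) 0 0, b).
Proof. by rewrite permE. Qed.

Lemma flipE Z y b : flip Z (y, b) = (y, b (+) (y \in Z)).
Proof. by rewrite permE. Qed.

Lemma reflection_affine : reflection \in affine_group.
Proof.
apply/affine_permsP; exists true, 0; apply/affineP=> c x b.
by rewrite reflectionE mulmx0 mxE mulN1r addr0.
Qed.

Lemma translation_affine a : translation a \in affine_group.
Proof.
apply/affine_permsP; exists false, a; apply/affineP=> c x b.
by rewrite translationE mul1r.
Qed.

Lemma flip_affine Z : flip Z \in affine_group.
Proof.
apply/affine_permsP; exists false, 0; apply/affineP=> c x b.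
by rewrite flipE mulmx0 mxE mul1r addr0.
Qed.

Lemma order_reflection : #[reflection]%g = 2.
Proof.
apply: nt_prime_order => //.
  by apply/permP=> -[[c x] b]; rewrite permM !reflectionE opprK perm1.
apply/eqP => /permP/(_ (0, 1, false)); rewrite reflectionE perm1.
by case.
Qed.

Lemma translation_p_elt a : (3.-elt (translation a))%g.
Proof.
apply: (@pnat_dvd _ 3) => //; rewrite order_dvdn; apply/eqP/permP=> -[[c x] b].
rewrite !expgS expg0 mulg1 !permM !translationE perm1 -!addrA.
rewrite -[X in x + X]/(_ *+ 3) -mulr_natr.
by rewrite (_ : 3%:R = 0 :> 'F_3) ?mulr0 ?addr0 //; apply/val_inj.
Qed.

Lemma translation_inverted a :
  (translation a ^ reflection = (translation a)^-1)%g.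
Proof.
apply: (mulgI reflection); rewrite -conjgC.
apply: (mulIg (translation a)); rewrite mulgKV.
apply/permP=> -[[c x] b]; rewrite !permM !(translationE, reflectionE).
by rewrite opprD addrNK.
Qed.

(** * Connecting the reflection to its conjugates by flips *)

Lemma flip_fixed_linked c :
  flip [set (c, 0)] \in linked affine_group 3 reflection.
Proof.
apply: mem_linked_commute (flip_affine _) _.
apply/permP=> -[[c' x] b]; rewrite !permM !(flipE, reflectionE).
by rewrite !inE !xpair_eqE oppr_eq0.
Qed.

Lemma flip_conj_translation c a :
  (flip [set (c, 0)] ^ translation a = flip [set (c, (c *m a) 0 0)])%g.
Proof.
apply: (mulgI (translation a)); rewrite -conjgC.
apply/permP=> -[[c' x] b]; rewrite !permM !(flipE, translationE) !inE.
rewrite !xpair_eqE; case: (c' =P c) => [->|] //=.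
by rewrite -[in RHS]subr_eq0 addrK.
Qed.

Lemma translation_linked a : translation a \in linked affine_group 3 reflection.
Proof.
apply: mem_linked_invert; rewrite ?order_reflection ?reflection_affine //.
- exact: translation_affine.
- exact: translation_p_elt.
- exact: translation_inverted.
Qed.

(** Induction on [#|Z|], splitting off the flip over one point [(c, x)], which is conjugate to the
    flip over [(c, 0)] by a translation. *)
Lemma flip_linked (Z : {set 'rV['F_3]_n * 'F_3}) :
  (forall y, y \in Z -> y.1 != 0) ->
  flip Z \in linked affine_group 3 reflection.
Proof.
have [m] := ubnP #|Z|; elim: m Z => // m IHm Z ltZm Z0.
have [->|[[c x] Zcx]] := set_0Vmem Z.
  suff -> : flip set0 = 1%g.
    exact: (group1 (linked_group 3 reflection_affine)).
  by apply/permP=> -[y b]; rewrite flipE inE addbF perm1.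
have -> : flip Z = (flip [set (c, x)] * flip (Z :\ (c, x)))%g.
  apply/permP=> -[y b]; rewrite permM !flipE !inE.
  by case: eqP => [->|]; rewrite ?Zcx addbF.
apply: (groupM (G := linked_group 3 reflection_affine)); last first.
  apply: IHm; last by move=> y /setD1P[_ /Z0].
  by rewrite (cardsD1 (c, x)) Zcx in ltZm.
have /rV0Pn[j cj] := Z0 _ Zcx.
(* A multiple of a basis vector with c(a) = x; it exists because c has a nonzero entry at [j]. *)
pose a : 'cV['F_3]_n := (x / c 0 j) *: delta_mx j 0.
have <- : (c *m a) 0 0 = x.
  rewrite /a -scalemxAr mxE mxE (bigD1 j) //= big1 => [|i /negPf ij].
    by rewrite mxE !eqxx mulr1 addr0 divfK.
  by rewrite mxE ij mulr0.
rewrite -flip_conj_translation.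
apply: (groupJ (G := linked_group 3 reflection_affine)).
  exact: flip_fixed_linked.
exact: translation_linked.
Qed.

(** * Products of few 3-elements *)

Lemma p_elt_translation q : q \in affine_group -> (3.-elt q)%g ->
  q \in translation_group.
Proof.
(* The square of [q] has sign + whatever [s] is. *)
move=> /affine_permsP[s [a qa]] q3; apply: (@p_elt_sq_mem _ 3 isT _ _ q3).
apply/translation_permsP; eexists.
by have := affineM qa qa; rewrite addbb; apply.
Qed.

(** The columns of [M] are the vectors [a] of the elements of [qs]. With fewer than [n] columns, [M]
    has a nonzero left kernel. *)
Lemma common_kernel (qs : seq {perm point}) :
  all (mem translation_perms) qs -> (size qs < n)%N ->
  exists2 c : 'rV['F_3]_n, c != 0 &
    forall q x b, q \in qs -> (q (c, x, b)).1 = (c, x).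
Proof.
move=> /allP qsT lt_qs.
have /fin_all_exists[f fP] (j : 'I_(size qs)) :
    exists a, tnth (in_tuple qs) j \in affine false a.
  by apply/translation_permsP/qsT/mem_tnth.
pose M := \matrix_(i < n, j < size qs) f j i 0.
have /rowV0Pn[c cM c0] : kermx M != 0.
  rewrite -mxrank_eq0 mxrank_ker subn_eq0 -ltnNge.
  exact: leq_ltn_trans (rank_leq_col M) lt_qs.
exists c => // q x b /(tnthP (in_tuple qs))[j ->].
have /affineP-> := fP j; rewrite expr0 mul1r.
move/sub_kermxP/matrixP/(_ 0 j): cM; rewrite !mxE => cM.
rewrite [X in x + X](_ : _ = 0) ?addr0 // -[RHS]cM.
by apply: eq_bigr => i _; rewrite !mxE.
Qed.

(** The two points over [y] are permuted by [q], so [q ^+ 2] fixes both; [p_elt_sq_mem] then applies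
    to the stabilizer of [(y, b)]. *)
Lemma p_elt_fix (q : {perm point}) y b :
  (3.-elt q)%g -> (forall b', (q (y, b')).1 = y) ->
  q (y, b) = (y, b).
Proof.
move=> q3 qy.
have qE b' : q (y, b') = (y, (q (y, b')).2).
  by rewrite [LHS]surjective_pairing qy.
suff : q \in 'C[(y, b) | 'P]%g by move/astab1P; apply.
apply: (@p_elt_sq_mem _ 3 isT _ _ q3); apply/astab1P.
rewrite expgS expg1 /= apermE permM.
have : (q (y, true)).2 != (q (y, false)).2.
  apply: contra_notN (_ : q (y, true) <> q (y, false)).
    by move=> /eqP eq2; rewrite qE eq2 -qE.
  by move/perm_inj.
have := qE true; have := qE false.
by case: (q (y, true)).2 (q (y, false)).2 b => [] [] // [] qf qt _;
  rewrite !(qf, qt).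
Qed.

End AffineGroup.

(** * The lower bound on the connected diameter *)

Lemma connected_diameter_gt (T : finType) (e : rel T) d x y :
  connect e x y -> (forall s, path e x s -> last x s = y -> d < size s) ->
  d < connected_diameter e.
Proof.
move=> cxy far.
(* The distance is the length of an actual walk, to which the bound applies. *)
have /walkP[s [es ls szs]] := gdist_walk cxy.
apply: leq_trans (far s es ls) _; rewrite szs.
have Cx : [set z | connect e x z] \in components e.
  by apply/componentsP; exists x.
apply: bigmax_sup Cx _; rewrite /diameter.
apply: (@bigmax_sup _ x); first by rewrite inE connect0.
by apply: (@leq_bigmax_cond _ _ _ y); rewrite inE.
Qed.

Theorem theorem3 (D : nat) (hD : 0 < D) :
  exists (gT : finGroupType) (G : {group gT}),
    solvable G /\ D < connected_diameter (local_commensurability G 3).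
Proof.
(* A walk of length at most [D] yields at most [D.+1] elements of 3-power order, and [common_kernel]
   needs fewer than [n]. *)
pose n := D.+2; exists {perm point n}, (affine_group n).
split; first exact: affine_group_solvable.
set G := affine_group n; set r := reflection n.
have rG : r \in G := reflection_affine n.
have or2 : #[r]%g = 2 := order_reflection n.
pose Z : {set 'rV['F_3]_n * 'F_3} := [set y | (y.1 != 0%R) && (y.2 == 1%R)].
have : flip Z \in linked G 3 r.
  by apply: flip_linked => y; rewrite inE => /andP[].
rewrite inE => /andP[zG /connected_diameter_gt]; apply=> s es ls.
rewrite ltnNge; apply/negP => les.
have [|||||qs sqs [qsP eqr]] :=
    path_prod_p_elt (isT : odd 3) es (u := r) (v := (r ^ flip Z)%g).
- rewrite val_subgroup_vertex ?cycle_subG // -[#|_|]/#[r]%g or2.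
  by rewrite part_pnat_id.
- by rewrite val_subgroup_vertex ?cycle_subG // cycle_id.
- exact: or2.
- by rewrite ls val_subgroup_vertex ?cycle_id ?cycle_subG ?groupJ.
- by rewrite orderJ.
have qsT : all (mem (translation_perms n)) qs.
  by apply: sub_all qsP => q /andP[qG q3]; apply: p_elt_translation.
have [|c c0 qsc] := common_kernel qsT; first by rewrite sqs.
have fix_qs x b : (\prod_(q <- qs) q)%g (c, x, b) = (c, x, b).
  rewrite big_seq; elim/big_ind: _ => [|g h gE hE|q qqs]; first exact: perm1.
    by rewrite permM gE hE.
  apply: p_elt_fix => [|b']; last exact: qsc.
  by case/andP: (allP qsP q qqs).
(* Multiplying by [flip Z] gives [r * flip Z] on one side and [flip Z], then the product, then [r]
   on the other. At [(c, 1, true)] the former keeps [true], since -1 differs from 1 in F_3 and so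
   [(c, -1)] is outside [Z]; the latter ends with [false]. *)
have := congr1 (fun g => flip Z * g)%g eqr; rewrite -conjgC.
move/permP/(_ (c, 1%R, true)); rewrite !permM !(reflectionE, flipE).
by rewrite !inE /= c0 fix_qs reflectionE /=; case.
Qed.
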